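(* Every nonrecursive c.e. $D$-maximal set $A$ of Type 8 or 9 represents the least finite-one degree inside its many-one degree, i.e. $A\le_{\rm fo}B$ for every set $B\equiv_{\rm m}A$.
   Context: All sets are subsets of $\omega$; $X\subseteq^* Y$ means $X\setminus Y$ is finite. $A\le_{\rm m}B$: there is total computable $f$ with $x\in A\iff f(x)\in B$; $\equiv_{\rm m}$ is mutual $\le_{\rm m}$. $A\le_{\rm fo}B$: there is total computable $g$ with $x\in A\iff g(x)\in B$ and every fibre $g^{-1}(\{y\})$ finite. A noncomputable c.e. set $A$ is $D$-maximal if for every c.e. $W\supseteq A$, either $W\setminus A$ is c.e. or there is a computable $R$ with $A\subseteq R\subseteq W$. For a c.e. set $A$, $\mathcal D(A)$ is the family of all c.e. sets disjoint from $A$; a finite or countable family $\{G_i:i\in I\}$ of c.e. sets disjoint from $A$ generates $\mathcal D(A)$ if every c.e. set $D$ disjoint from $A$ satisfies $D\subseteq^*\bigcup_{i\in F}G_i$ for some finite $F\subseteq I$. Generating family types: Type 1: $\{\varnothing\}$. Type 2: $\{R\}$, $R$ infinite computable. Type 3: $\{W\}$, $W$ infinite noncomputable c.e. Type 4: $\{R_0,R_1,\dots\}$, infinite pairwise disjoint computable. Type 5: $\{D_0,R_0,R_1,\dots\}$, $D_0$ noncomputable c.e., $R_i$ computable, all infinite and pairwise disjoint. Type 6: $\{D_0,D_1,\dots\}$, infinite pairwise disjoint noncomputable c.e. Type 7: $\{D_0,R_0,R_1,\dots\}$, $D_0$ noncomputable c.e., $R_i$ infinite pairwise disjoint computable, $D_0\cap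 R_i\ne\varnothing$ for infinitely many $i$. Type 8: $\{D_0,D_1,\dots,R_0,R_1,\dots\}$, the $D_i$ pairwise disjoint noncomputable c.e. sets and the $R_i$ infinite pairwise disjoint computable sets. Type 9: $\{D_0,D_1,\dots,R_0,R_1,\dots\}$, the $R_i$ infinite pairwise disjoint computable sets, the $D_i$ infinite nested ($D_0\subseteq D_1\subseteq\cdots$) noncomputable c.e. sets with $D_{\ell+1}\setminus D_\ell$ not c.e. for all $\ell$, and for every $\ell$ there are infinitely many $j$ with $R_j\setminus D_\ell$ infinite. A c.e. set $A$ is of Type $n$ if $\mathcal D(A)$ has a generating family of Type $n$ and none of Type $m$ for any $m<n$. *)

(* Defs.v *)
From mathcomp Require Import all_boot all_order.
From mathcomp Require Import boolp classical_sets functions cardinality.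

Set Implicit Arguments.
Unset Strict Implicit.
Unset Printing Implicit Defensive.

Local Open Scope classical_set_scope.

(* A partial function from nat^k to nat is represented by its graph. *)
Definition pfun (k : nat) := k.-tuple nat -> nat -> Prop.

Definition pcomp k m (g : pfun m) (h : 'I_m -> pfun k) : pfun k :=
  fun v y => exists w : m.-tuple nat,
    (forall i, h i v (tnth w i)) /\ g w y.

Fixpoint prec_graph k (g : pfun k) (h : pfun k.+2) (v : k.-tuple nat) (n : nat)
    : nat -> Prop :=
  match n with
  | 0 => g v
  | n'.+1 => fun y => exists z,
      prec_graph g h v n' z /\ h [tuple of n' :: z :: v] y
  end.

(* The recursion variable is the first argument. *)
Definition pprec k (g : pfun k) (h : pfun k.+2) : pfun k.+1 :=
  fun v y => prec_graph g h [tuple of behead v] (thead v) y.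

(* Unbounded search diverges as soon as g is undefined at some j below the
   first zero. *)
Definition pmu k (g : pfun k.+1) : pfun k :=
  fun v y => g [tuple of y :: v] 0 /\
    forall j, j < y -> exists z, g [tuple of j :: v] z /\ z <> 0.

Inductive partial_recursive : forall k, pfun k -> Prop :=
| PRzero : @partial_recursive 0 (fun _ y => y = 0)
| PRsucc : @partial_recursive 1 (fun v y => y = (thead v).+1)
| PRproj k (i : 'I_k) : @partial_recursive k (fun v y => y = tnth v i)
| PRcomp k m (g : pfun m) (h : 'I_m -> pfun k) :
    partial_recursive g -> (forall i, partial_recursive (h i)) ->
    partial_recursive (pcomp g h)
| PRprec k (g : pfun k) (h : pfun k.+2) :
    partial_recursive g -> partial_recursive h ->
    partial_recursive (pprec g h)
| PRmu k (g : pfun k.+1) :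
    partial_recursive g -> partial_recursive (pmu g).

Definition computable_fun (f : nat -> nat) : Prop :=
  @partial_recursive 1 (fun v y => y = f (thead v)).

Definition computable (X : set nat) : Prop :=
  computable_fun (fun x => nat_of_bool (x \in X)).

Definition ce (X : set nat) : Prop :=
  X = set0 \/ exists2 f : nat -> nat, computable_fun f & X = range f.

Definition noncomputable_ce (X : set nat) : Prop := ce X /\ ~ computable X.

Definition almost_subset (X Y : set nat) : Prop := finite_set (X `\` Y).

Definition m_reducible (A B : set nat) : Prop :=
  exists2 f : nat -> nat, computable_fun f & forall x, A x <-> B (f x).

Definition m_equivalent (A B : set nat) : Prop :=
  m_reducible A B /\ m_reducible B A.

Definition fo_reducible (A B : set nat) : Prop :=
  exists g : nat -> nat, [/\ computable_fun g,
    forall x, A x <-> B (g x) &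
    forall y, finite_set (g @^-1` [set y])].

Definition D_maximal (A : set nat) : Prop :=
  noncomputable_ce A /\
  forall W, ce W -> A `<=` W ->
    ce (W `\` A) \/ exists R : set nat, [/\ computable R, A `<=` R & R `<=` W].

Definition ce_disjoint (A : set nat) : set (set nat) :=
  [set D | ce D /\ D `&` A = set0].

Definition generates (A : set nat) (G : set (set nat)) : Prop :=
  [/\ countable G, G `<=` ce_disjoint A &
    forall D, ce_disjoint A D ->
      exists F : set (set nat), [/\ finite_set F, F `<=` G &
        almost_subset D (\bigcup_(X in F) X)]].

Definition infinite_disjoint_computable (R : nat -> set nat) : Prop :=
  [/\ forall i, computable (R i), forall i, infinite_set (R i) &
    trivIset setT R].

Definition family_type (n : nat) (G : set (set nat)) : Prop :=
  match n with
  | 1 => G = [set set0]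
  | 2 => exists R : set nat, [/\ computable R, infinite_set R & G = [set R]]
  | 3 => exists W : set nat,
           [/\ noncomputable_ce W, infinite_set W & G = [set W]]
  | 4 => exists2 R : nat -> set nat,
           infinite_disjoint_computable R & G = range R
  | 5 => exists (D : set nat) (R : nat -> set nat),
         [/\ noncomputable_ce D /\ infinite_set D,
           infinite_disjoint_computable R,
           forall i, D `&` R i = set0 &
           G = [set D] `|` range R]
  | 6 => exists D : nat -> set nat, [/\ forall i, noncomputable_ce (D i),
           forall i, infinite_set (D i), trivIset setT D & G = range D]
  | 7 => exists (D : set nat) (R : nat -> set nat),
         [/\ noncomputable_ce D,
           infinite_disjoint_computable R,
           infinite_set [set i | D `&` R i !=set0] &
           G = [set D] `|` range R]
  | 8 => exists D R : nat -> set nat, [/\ forall i, noncomputable_ce (D i),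
           trivIset setT D,
           infinite_disjoint_computable R &
           G = range D `|` range R]
  | 9 => exists D R : nat -> set nat, [/\ infinite_disjoint_computable R,
           forall l, [/\ noncomputable_ce (D l), infinite_set (D l),
             D l `<=` D l.+1 & ~ ce (D l.+1 `\` D l)],
           forall l, infinite_set [set j | infinite_set (R j `\` D l)] &
           G = range D `|` range R]
  | _ => False
  end.

Definition has_family_type (A : set nat) (n : nat) : Prop :=
  exists2 G, family_type n G & generates A G.

Definition of_type (A : set nat) (n : nat) : Prop :=
  [/\ ce A, has_family_type A n & forall m, m < n -> ~ has_family_type A m].

(* Main.v *)
(* Let f reduce A to B, let r x be the least element of the fibre of f through x,
   and let C be the computable set of the x with r x <> x, so that f is injective
   off C.  Apply D-maximality to A `|` C.  A computable R between A and A `|` C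
   would give A = r^-1(R), because r avoids C, and A would be computable.  Hence
   C `\` A is c.e. and A splits C computably.  If the complement of B contains an
   infinite c.e. set V, keep f off C, and redefine it to be finite-one from
   A `&` C into f(A) and from C `\` A into V.  Otherwise every c.e. set disjoint
   from A has a finite image under f, so the infinite fibres of f over the
   complement of B generate D(A); then A has a generating family of Type 1, 2
   or 4, according to whether there are none, finitely many or infinitely many
   such fibres. *)
Require Import Defs.
From mathcomp Require Import all_boot all_order.
From mathcomp Require Import boolp classical_sets functions cardinality.

Set Implicit Arguments.
Unset Strict Implicit.
Unset Printing Implicit Defensive.

Local Open Scope classical_set_scope.

(** * Closure properties of total recursive functions *)

(** A total function enters the inductive class through its graph; [computable_fun] is by conversion
    the unary case. *)
Definition recursive k (F : k.-tuple nat -> nat) : Prop :=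
  partial_recursive (fun v y => y = F v).

Lemma recursive_ext k (F G : k.-tuple nat -> nat) :
  F =1 G -> recursive F -> recursive G.
Proof. by move=> /funext ->. Qed.

Lemma recursive_proj k (i : 'I_k) : recursive (fun v : k.-tuple nat => tnth v i).
Proof. exact: PRproj. Qed.

Lemma recursive_comp k m (G : m.-tuple nat -> nat)
    (H : 'I_m -> k.-tuple nat -> nat) :
  recursive G -> (forall i, recursive (H i)) ->
  recursive (fun v => G [tuple H i v | i < m]).
Proof.
move=> rG rH; have := PRcomp rG rH; rewrite /recursive.
congr (partial_recursive _); apply/funext => v; apply/funext => y.
apply/propext; split=> [[w [wE ->]]|->].
  congr G; apply: eq_from_tnth => i; rewrite tnth_mktuple; exact: wE.
by exists [tuple H i v | i < m]; split=> // i; rewrite tnth_mktuple.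
Qed.

Lemma recursive_app1 k f (F : k.-tuple nat -> nat) :
  computable_fun f -> recursive F -> recursive (fun v => f (F v)).
Proof.
move=> rf rF.
apply: recursive_ext (@recursive_comp k 1 _ (fun=> F) rf (fun=> rF)) => v.
by rewrite /thead tnth_mktuple.
Qed.

Lemma recursive_app2 k (f : nat -> nat -> nat) (F G : k.-tuple nat -> nat) :
  recursive (fun v : 2.-tuple nat => f (tnth v ord0) (tnth v ord_max)) ->
  recursive F -> recursive G -> recursive (fun v => f (F v) (G v)).
Proof.
move=> rf rF rG; pose H (i : 'I_2) := if i == ord0 then F else G.
have rH i : recursive (H i) by rewrite /H; case: ifP.
apply: recursive_ext (recursive_comp rf rH) => v.
by rewrite !tnth_mktuple.
Qed.

Lemma recursive_app3 k (f : nat -> nat -> nat -> nat)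
    (E F G : k.-tuple nat -> nat) :
  recursive (fun v : 3.-tuple nat =>
    f (tnth v ord0) (tnth v (inord 1)) (tnth v ord_max)) ->
  recursive E -> recursive F -> recursive G ->
  recursive (fun v => f (E v) (F v) (G v)).
Proof.
move=> rf rE rF rG.
pose H (i : 'I_3) := if val i == 0 then E else if val i == 1 then F else G.
have rH i : recursive (H i) by rewrite /H; do 2 case: ifP => //.
apply: recursive_ext (recursive_comp rf rH) => v.
by rewrite !tnth_mktuple /H /= inordK.
Qed.

(** [P] may be given in closed form: only its two recursion equations are checked, so functions such
    as [predn] and [half] are usable as they stand. *)
Lemma recursive_prec k (G : k.-tuple nat -> nat) (H : k.+2.-tuple nat -> nat)
    (P : nat -> k.-tuple nat -> nat) :
  (forall v, P 0 v = G v) ->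
  (forall n v, P n.+1 v = H [tuple of n :: P n v :: v]) ->
  recursive G -> recursive H ->
  recursive (fun v : k.+1.-tuple nat => P (thead v) [tuple of behead v]).
Proof.
move=> P0 PS rG rH; have := PRprec rG rH; rewrite /recursive.
congr (partial_recursive _); apply/funext => v; apply/funext => y.
rewrite /pprec; move: (thead v) [tuple of behead v] => n w.
elim: n y => [|n IHn] y /=; first by rewrite P0.
rewrite PS; apply/propext; split=> [[z []]|->]; first by rewrite IHn => -> ->.
by exists (P n w); rewrite IHn.
Qed.

Lemma recursive_const k n : recursive (fun _ : k.-tuple nat => n).
Proof.
elim: n => [|n IHn]; last exact: (recursive_app1 PRsucc IHn).
(* The nullary zero is lifted to arity [k] by composing it with an empty family. *)
have H (i : 'I_0) : k.-tuple nat -> nat by case: i.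
apply: (@recursive_comp k 0 (fun=> 0) H PRzero) => i; by case: i.
Qed.

Lemma recursive_prec0 c (h : nat -> nat -> nat) (P : nat -> nat) :
  recursive (fun v : 2.-tuple nat => h (tnth v ord0) (tnth v ord_max)) ->
  P 0 = c -> (forall n, P n.+1 = h n (P n)) -> computable_fun P.
Proof.
move=> rh P0 PS.
by apply: (@recursive_prec 0 _ _ (fun n _ => P n) _ _ (recursive_const 0 c) rh).
Qed.

Lemma computable_pred : computable_fun predn.
Proof. by apply: (@recursive_prec0 0 (fun n _ => n)) => //; exact: PRproj. Qed.

Lemma recursive_sub k (F G : k.-tuple nat -> nat) :
  recursive F -> recursive G -> recursive (fun v => F v - G v).
Proof.
(* The recursion runs on the subtrahend, which therefore becomes the first argument. *)
move=> rF rG; apply: (@recursive_app2 _ (fun n x => x - n)) => //.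
have rH : recursive (fun v : 3.-tuple nat => (tnth v (inord 1)).-1).
  exact: recursive_app1 computable_pred (recursive_proj _).
apply: recursive_ext (@recursive_prec 1 (fun v => tnth v ord0) _
  (fun n w => tnth w ord0 - n) _ _ (recursive_proj _) rH) => [v|v|n v].
- rewrite /thead; congr (_ - _); case/tupleP: v => a w.
  by case/tupleP: w => b w; rewrite !(tnth_nth 0).
- by rewrite subn0.
- by rewrite subnS [in RHS](tnth_nth 0) inordK.
Qed.

Lemma recursive_if k (b : k.-tuple nat -> bool) (F G : k.-tuple nat -> nat) :
  recursive (fun v => nat_of_bool (b v)) -> recursive F -> recursive G ->
  recursive (fun v => if b v then F v else G v).
Proof.
move=> rb rF rG.
(* Case distinction is a recursion on the truth value: the base case selects [G], and the step
   discards the previous value and selects [F]. *)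
apply: (@recursive_ext _ (fun v => if (b v : nat) == 0 then G v else F v)).
  by move=> v; case: (b v).
apply: (@recursive_app3 _ (fun n x y => if n == 0 then x else y)) => //.
apply: recursive_ext (@recursive_prec 2 (fun v => tnth v ord0)
  (fun v => tnth v ord_max)
  (fun n w => if n == 0 then tnth w ord0 else tnth w ord_max) _ _
  (recursive_proj _) (recursive_proj _)) => // [v|n v].
- rewrite /thead; case/tupleP: v => a w; case/tupleP: w => d w.
  by case/tupleP: w => c w; rewrite !(tnth_nth 0) inordK.
- by rewrite !(tnth_nth 0).
Qed.

Lemma recursive_leq k (F G : k.-tuple nat -> nat) :
  recursive F -> recursive G -> recursive (fun v => nat_of_bool (F v <= G v)).
Proof.
move=> rF rG.
have r0 : computable_fun (fun n => nat_of_bool (n == 0)).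
  by apply: (@recursive_prec0 1 (fun _ _ => 0)) => //; exact: recursive_const.
(* [m <= n] unfolds to [m - n == 0]. *)
exact: recursive_app1 r0 (recursive_sub rF rG).
Qed.

Lemma recursive_and k (b c : k.-tuple nat -> bool) :
  recursive (fun v => nat_of_bool (b v)) ->
  recursive (fun v => nat_of_bool (c v)) ->
  recursive (fun v => nat_of_bool (b v && c v)).
Proof.
move=> rb rc; apply: recursive_ext (recursive_if rb rc (recursive_const k 0)).
by move=> v; case: (b v).
Qed.

Lemma recursive_neg k (b : k.-tuple nat -> bool) :
  recursive (fun v => nat_of_bool (b v)) ->
  recursive (fun v => nat_of_bool (~~ b v)).
Proof.
move=> rb.
apply: recursive_ext
  (recursive_if rb (recursive_const k 0) (recursive_const k 1)).
by move=> v; case: (b v).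
Qed.

Lemma recursive_or k (b c : k.-tuple nat -> bool) :
  recursive (fun v => nat_of_bool (b v)) ->
  recursive (fun v => nat_of_bool (c v)) ->
  recursive (fun v => nat_of_bool (b v || c v)).
Proof.
move=> rb rc; apply: recursive_ext (recursive_if rb (recursive_const k 1) rc).
by move=> v; case: (b v).
Qed.

Lemma recursive_eq k (F G : k.-tuple nat -> nat) :
  recursive F -> recursive G -> recursive (fun v => nat_of_bool (F v == G v)).
Proof.
move=> rF rG.
apply: recursive_ext
  (recursive_and (recursive_leq rF rG) (recursive_leq rG rF)).
by move=> v; rewrite eqn_leq.
Qed.

(** * Unbounded search *)

Lemma recursive_search k (p : k.+1.-tuple nat -> bool) :
  recursive (fun v => nat_of_bool (p v)) ->
  (forall v : k.-tuple nat, exists y, p [tuple of y :: v]) ->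
  exists2 m : k.-tuple nat -> nat, recursive m &
    forall v, p [tuple of m v :: v] /\
      forall j, p [tuple of j :: v] -> m v <= j.
Proof.
(* [pmu] looks for a zero, so the predicate enters negated. *)
move=> /recursive_neg rp ex; exists (fun v => ex_minn (ex v)); last first.
  by move=> v; case: ex_minnP.
have := PRmu rp; rewrite /recursive.
congr (partial_recursive _); apply/funext => v; apply/funext => y.
case: ex_minnP => m pm mmin; apply/propext; split=> [[py ylt]|->].
  apply/eqP; rewrite eqn_leq; apply/andP; split; last first.
    by apply: mmin; move: py; case: (p _).
  rewrite leqNgt; apply/negP => /ylt[z [-> ]].
  by rewrite pm.
split=> [|j jm]; first by rewrite pm.
exists (~~ p [tuple of j :: v]); split=> //.
by case: (boolP (p _)) => // /mmin; rewrite leqNgt jm.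
Qed.

Lemma computable_search (p : nat -> nat -> bool) :
  recursive (fun v : 2.-tuple nat =>
    nat_of_bool (p (tnth v ord0) (tnth v ord_max))) ->
  (forall x, exists y, p y x) ->
  exists2 m : nat -> nat, computable_fun m &
    forall x, p (m x) x /\ forall j, p j x -> m x <= j.
Proof.
move=> rp ex.
have [v|m rm mP] := recursive_search rp.
  have [y py] := ex (tnth v ord0); exists y.
  by case/tupleP: v py => a w; rewrite !(tnth_nth 0).
exists (fun x => m [tuple x]) => [|x]; last first.
  by have := mP [tuple x].
apply: recursive_ext rm => v; congr m; apply: eq_from_tnth => i.
by rewrite ord1 [RHS](tnth_nth 0).
Qed.

Lemma computable_comp f g :
  computable_fun f -> computable_fun g -> computable_fun (fun x => f (g x)).
Proof. exact: recursive_app1. Qed.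

(** * Computable and c.e. sets *)

Lemma computable_pred_set (X : set nat) (b : nat -> bool) :
  computable_fun (fun x => nat_of_bool (b x)) -> (forall x, X x <-> b x) ->
  computable X.
Proof.
move=> rb Xb; apply: recursive_ext rb => v; congr nat_of_bool.
by apply/idP/idP => [/Xb/mem_set //|/set_mem/Xb].
Qed.

Lemma computable_preimage f X :
  computable_fun f -> computable X -> computable (f @^-1` X).
Proof.
move=> rf rX; apply: computable_pred_set (computable_comp rX rf) _ => x /=.
by split=> [/mem_set|/set_mem].
Qed.

Lemma finite_computable X : finite_set X -> computable X.
Proof.
move=> /finite_seqP[s ->].
apply: (@computable_pred_set _ (fun x => x \in s)) => [|x]; last by [].
elim: s => [|a s IHs]; first exact: recursive_const.
apply: recursive_ext (recursive_or
  (recursive_eq (recursive_proj ord0) (recursive_const 1 a)) IHs).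
by move=> v; rewrite in_cons.
Qed.

Lemma ce_image f X : computable_fun f -> ce X -> ce (f @` X).
Proof.
move=> rf [->|[a ra ->]]; first by left; rewrite image_set0.
right; exists (fun x => f (a x)); first exact: computable_comp.
by rewrite -(image_comp a f).
Qed.

Lemma ceU_computable A C : ce A -> A !=set0 -> computable C -> ce (A `|` C).
Proof.
move=> [->|[a ra AE]]; first by case.
move=> _ rC.
have rodd : computable_fun (fun n => nat_of_bool (odd n)).
  apply: (@recursive_prec0 0 (fun _ z => nat_of_bool (z == 0))) => // [|n].
    exact: recursive_eq (recursive_proj _) (recursive_const _ _).
  by rewrite oddS; case: odd.
have rhalf : computable_fun half.
  apply: (@recursive_prec0 0 (fun n z => if odd n then z.+1 else z)) => // [|n].
    apply: recursive_if (recursive_app1 PRsucc (recursive_proj _)) _.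
      exact: recursive_app1 rodd (recursive_proj _).
    exact: recursive_proj.
  by rewrite -uphalfE uphalf_half; case: odd.
(* Even arguments enumerate [A]; an odd one yields its half if that lies in [C], and otherwise falls
   back on a value of [a]. *)
right; exists (fun n => if odd n && (n./2 \in C) then n./2 else a n./2).
  apply: recursive_if => //.
    by apply: recursive_and; [exact: rodd|exact: computable_comp rC rhalf].
  exact: computable_comp ra rhalf.
rewrite AE; apply/seteqP; split=> [x [[n _ <-]|Cx]|_ [n _ <-]] /=.
- by exists n.*2; rewrite ?odd_double ?doubleK.
- by exists x.*2.+1 => //=; rewrite odd_double /= uphalf_double (mem_set Cx).
- by case: ifP => [/andP[_ /set_mem]|_]; [right|left; exists n./2].
Qed.

(** Each point of [C] shows up in exactly one of the enumerations of [A] and [Q], so waiting for it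
    decides membership; off [C] the search stops at once. *)
Lemma computable_ce_split A Q C :
  ce A -> ce Q -> computable C -> A `&` Q = set0 -> C `<=` A `|` Q ->
  computable (A `&` C).
Proof.
move=> [->|[a ra AE]].
  by move=> *; rewrite set0I; exact: finite_computable.
move=> [->|[q rq QE]] rC AQ0 CAQ.
  by move: CAQ; rewrite setU0 => /setIidr ->.
pose p n x := (x \notin C) || (a n == x) || (q n == x).
have [|x|s rs sP] := @computable_search p.
- apply: recursive_or; [apply: recursive_or|].
  + exact: recursive_neg (recursive_app1 rC (recursive_proj _)).
  + exact: recursive_eq (recursive_app1 ra (recursive_proj _)) (recursive_proj _).
  + exact: recursive_eq (recursive_app1 rq (recursive_proj _)) (recursive_proj _).
- have [/set_mem/CAQ|xC] := boolP (x \in C); last by exists 0; rewrite /p xC.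
  rewrite AE QE => -[[n _ <-]|[n _ <-]]; exists n; rewrite /p eqxx ?orbT //.
apply: (@computable_pred_set _ (fun x => (x \in C) && (a (s x) == x))) => [|x].
  apply: recursive_and => //.
  exact: recursive_eq (computable_comp ra rs) (recursive_proj _).
split=> [[Ax Cx]|/andP[/set_mem Cx /eqP asx]]; last first.
  by split=> //; rewrite AE; exists (s x).
rewrite (mem_set Cx); have [+ _] := sP x; rewrite /p (mem_set Cx) /=.
case/orP => // /eqP qx; suff : (A `&` Q) x by rewrite AQ0.
by split=> //; rewrite QE; exists (s x).
Qed.

Lemma computable_ce X : computable X -> ce X.
Proof.
have [-> _|/set0P[x Xx] rX] := eqVneq X set0; first by left.
have -> : X = [set x] `|` X by apply/esym/setUidr => _ ->.
apply: ceU_computable rX; last by exists x.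
right; exists (fun=> x); first exact: recursive_const.
by apply/seteqP; split=> [_ ->|_ [_ _ <-]] //; exists 0.
Qed.

(* The bound [x <= e x] makes [e] finite-one. *)
Lemma ce_infinite_section V :
  ce V -> infinite_set V ->
  exists e : nat -> nat, [/\ computable_fun e, forall x, V (e x) &
    forall x, x <= e x].
Proof.
move=> [->|[v rv ->]] Vinf; first by case: Vinf.
have [|x|s rs sP] := @computable_search (fun n x => x <= v n).
- exact: recursive_leq (recursive_proj _) (recursive_app1 rv (recursive_proj _)).
- apply: contrapT => vx; apply: Vinf; apply: sub_finite_set (finite_II x).
  by move=> _ [n _ <-] /=; rewrite ltnNge; apply/negP => ?; apply: vx; exists n.
by exists (fun x => v (s x)); split=> [|x|x]; [exact: computable_comp|exists (s x)|have [] := sP x].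
Qed.

(** The search halts because [x] itself qualifies. Its result depends only on [f x], so [r] selects
    one representative of each fibre. *)
Lemma least_preimage f : computable_fun f ->
  exists2 r : nat -> nat, computable_fun r &
    forall x, f (r x) = f x /\ forall z, f z = f x -> r x <= z.
Proof.
move=> rf; have [|x|r rr rP] := @computable_search (fun z x => f z == f x).
- by apply: recursive_eq; apply: recursive_app1 => //; exact: recursive_proj.
- by exists x.
exists r => // x; have [/eqP ? rmin] := rP x; split=> // z fzx.
by apply: rmin; apply/eqP.
Qed.

(** * Generating families made of fibres *)

(** The last hypothesis says that the complement of [B] is finite or immune. All fibres of [f] are
    computable, and a c.e. set disjoint from [A] meets only finitely many of them. *)
Lemma low_type_of_immune_complement A B f : computable_fun f ->
  (forall x, A x <-> B (f x)) ->
  ~ (exists V, [/\ ce V, infinite_set V & V `&` B = set0]) ->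
  has_family_type A 1 \/ has_family_type A 2 \/ has_family_type A 4.
Proof.
move=> rf AB immune.
pose Y := [set y | ~ B y /\ infinite_set (f @^-1` [set y])].
have YD Z : finite_set Z -> Z `<=` Y -> ce_disjoint A (f @^-1` Z).
  move=> Zfin ZY; split.
    exact/computable_ce/computable_preimage/finite_computable.
  by rewrite -subset0 => x [/= /ZY[nB _] /AB].
have gen D : ce_disjoint A D ->
    exists Z, [/\ finite_set Z, Z `<=` Y & almost_subset D (f @^-1` Z)].
  move=> [ceD DA0].
  have DB y : (f @` D) y -> ~ B y.
    by move=> [x Dx <-] /AB Ax; suff : (D `&` A) x by rewrite DA0.
  have fDfin : finite_set (f @` D).
    apply: contrapT => fDinf; apply: immune; exists (f @` D); split=> //.
      exact: ce_image.
    by rewrite -subset0 => y [/DB].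
  exists (f @` D `&` Y); split=> [||]; [exact: finite_setIl|by move=> ? []|].
  (* What is left of [D] lies in finitely many fibres, all finite because their values are outside
     both [B] and [Y]. *)
  apply: (@sub_finite_set _ _ (\bigcup_(y in f @` D `\` Y) f @^-1` [set y])).
    move=> x [Dx nY]; exists (f x) => //; split; first by exists x.
    by move=> Yfx; apply: nY; split=> //; exists x.
  apply: bigcup_finite; first exact: finite_setD.
  by move=> y [/DB nB nY]; apply: contrapT => ?; apply: nY.
have [Y0|/set0P[y0 Yy0]] := eqVneq Y set0.
  left; exists [set set0] => //; split; first exact: finite_set_countable.
    move=> _ ->; split; [by left|exact: set0I].
  move=> D /gen[Z [_ ZY DZ]]; exists set0; split=> //.
  have Z0 : Z = set0 by apply/seteqP; split=> // y /ZY; rewrite Y0.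
  by rewrite bigcup_set0; move: DZ; rewrite Z0 preimage_set0.
(* Finitely many infinite fibres merge into one infinite computable set. *)
have [Yfin|Yinf] := pselect (finite_set Y).
  right; left; exists [set f @^-1` Y].
    exists (f @^-1` Y); split=> //.
      exact: computable_preimage (finite_computable Yfin).
    have [_] := Yy0; apply: sub_infinite_set => x /= ->; exact: Yy0.
  split; first exact: finite_set_countable.
    by move=> _ ->; apply: YD.
  move=> D /gen[Z [_ ZY DZ]]; exists [set f @^-1` Y]; split=> //.
  apply: sub_finite_set DZ; rewrite bigcup_set1.
  by apply: setDS; exact: preimage_subset.
right; right.
(* The enumeration [phi] of [Y] need not be computable: Type 4 asks for each set to be computable,
   not for uniformity. *)
have /card_esym/card_set_bijP[phi [phiY phiI phiS]] :=
  eq_card_nat (countableP Y) Yinf.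
exists (range (fun i => f @^-1` [set phi i])).
  exists (fun i => f @^-1` [set phi i]) => //; split=> [i|i|].
  - exact/computable_preimage/finite_computable.
  - by have [] := phiY i I.
  - apply/trivIsetP => i j _ _ ij; rewrite -subset0 => x [/= -> /phiI eij].
    by rewrite eij ?inE ?eqxx in ij.
split; first exact: card_image_le.
  by move=> _ [i _ <-]; apply: YD => // _ ->; exact: phiY.
move=> D /gen[Z [Zfin ZY DZ]].
exists ((fun y => f @^-1` [set y]) @` Z); split.
- exact: finite_image.
- by move=> _ [y /ZY/phiS[i _ <-] <-]; exists i.
- apply: sub_finite_set DZ; apply: setDS => x Zfx.
  by exists (f @^-1` [set f x]) => //; exists (f x).
Qed.

(** * Construction of the finite-one reduction *)

Theorem theorem6p7 (A : set nat) :
  noncomputable_ce A -> D_maximal A -> of_type A 8 \/ of_type A 9 ->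
  forall B : set nat, m_equivalent B A -> fo_reducible A B.
Proof.
move=> [ceA ncA] [_ Dmax] Atype B [_ [f rf AB]].
have [[V [ceV Vinf VB0]]|immune] :=
    pselect (exists V, [/\ ce V, infinite_set V & V `&` B = set0]); last first.
  (* Types 8 and 9 both exclude generating families of every type below 8. *)
  have nt m : m < 8 -> ~ has_family_type A m.
    by move=> m8; case: Atype => -[_ _]; apply=> //; exact: ltnW.
  by have [/nt|[/nt|/nt]] := low_type_of_immune_complement rf AB immune; case.
have [r rr rP] := least_preimage rf.
pose C := [set x | r x <> x].
have rC : computable C.
  apply: (@computable_pred_set _ (fun x => r x != x)) => [|x]; last first.
    by split=> [/eqP|/eqP].
  exact: recursive_neg (recursive_eq rr (recursive_proj _)).
(* [r] is idempotent: [x] and [r x] lie in the same fibre and so have the same least element. *)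
have rCn x : ~ C (r x).
  apply; apply/eqP; rewrite eqn_leq; have [e1 _] := rP x.
  have [e2 m2] := rP (r x); have [_ m1] := rP x.
  by rewrite m1 ?e2 // m2.
have Ar x : A x <-> A (r x) by rewrite !AB; have [->] := rP x.
have A0 : A !=set0.
  by apply/set0P/eqP => A0; apply: ncA; rewrite A0; exact: finite_computable.
have ceCA : ce (C `\` A).
  have [||+|[R [rR AR RAC]]] := Dmax (A `|` C); first exact: ceU_computable.
  - exact: subsetUl.
  - by rewrite setDUl setDv set0U.
  case: ncA; suff -> : A = r @^-1` R by exact: computable_preimage.
  apply/seteqP; split=> [x /Ar/AR //|x /= /RAC[Arx|/rCn //]].
  exact/Ar.
have rAC : computable (A `&` C).
  apply: computable_ce_split ceCA rC _ _ => //; first by rewrite setDIK.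
  by move=> x Cx; have [|] := pselect (A x); [left|right].
(* [A] is the full preimage of its image under [f], so a finite image would make [A] computable. *)
have fAinf : infinite_set (f @` A).
  move=> fAfin; apply: ncA.
  suff -> : A = f @^-1` (f @` A).
    exact: computable_preimage (finite_computable fAfin).
  apply/seteqP; split=> [x Ax|x [z /AB ? fzx]]; first by exists x.
  by apply/AB; rewrite -fzx.
(* [e] takes its values inside [B] and [d] outside it; both bound their argument. *)
have [e [re eA ele]] := ce_infinite_section (ce_image rf ceA) fAinf.
have [d [rd dV dle]] := ce_infinite_section ceV Vinf.
exists (fun x => if x \in A `&` C then e x else if x \in C then d x else f x).
split=> [|x|y].
- by apply: recursive_if => //; exact: recursive_if.
- case: ifPn => [/set_mem[Ax _]|/negP nAC].
    by split=> // _; have [z /AB + <-] := eA x.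
  case: ifPn => [/set_mem Cx|_]; last exact: AB.
  split=> [Ax|Bdx]; first by case: nAC; exact/mem_set.
  by suff : (V `&` B) (d x) by rewrite VB0.
- pose S := [set x | ~ C x /\ f x = y].
  (* A point sent to [y] by [e] or [d] is at most [y]; any other point of the fibre lies in [S]. *)
  apply: (@sub_finite_set _ _ (`I_y.+1 `|` S)).
    move=> x /=; case: ifPn => [_ <-|_]; first by left; rewrite /= ltnS.
    case: ifPn => [_ <-|nC fxy]; first by left; rewrite /= ltnS.
    by right; split=> // /mem_set; apply/negP.
  rewrite finite_setU; split; first exact: finite_II.
  have [S0|/set0P[x0 [nC0 fx0]]] := eqVneq S set0; first by rewrite S0.
  (* [S] has at most one element, since a point off [C] is the least of its fibre under [f]. *)
  apply: sub_finite_set (finite_set1 x0) => x [nC fx].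
  have /contrapT rx := nC; have /contrapT rx0 := nC0.
  have [_ m] := rP x; have [_ m0] := rP x0.
  rewrite rx in m; rewrite rx0 in m0.
  by apply/eqP; rewrite eqn_leq m ?m0 ?fx ?fx0.
Qed.
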